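(* Let $M$ be a real $n\times n$ matrix. A $k$-dimensional subspace $W\subset\mathbb{R}^n$ is $M$-invariant if and only if $W$ has a basis consisting of a set of Jordan vectors for $M$.
   Context: A vector subspace $V\subset\mathbb{R}^n$ is said to be $M$-invariant if $Mv\in V$ for all $v\in V$. For a square matrix $M\in\mathbb{R}^{n\times n}$, a sequence of vectors $x_0,x_1,\ldots,x_m$ is called a Jordan chain of $M$ corresponding to $\lambda_0$ if $x_0\neq 0$, $Mx_0=\lambda_0x_0$, and $Mx_j-\lambda_0x_j=x_{j-1}$ for $j=1,\ldots,m$ (so $x_0$ is an eigenvector of $M$ corresponding to $\lambda_0$). A set of Jordan vectors for $M\in\mathbb{R}^{n\times n}$ is a set of linearly independent vectors in $\mathbb{C}^n$ made up of a union of Jordan chains of $M$.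
   Formalization: ''W has a basis'' is read as: the complex span of W in C^n has a basis of k (complex) Jordan vectors; with basis vectors in W itself, hence real, the claim fails, e.g. for the rotation of R^2 by 90 degrees and W = R^2. *)

(* Defs.v *)
(* MathComp; the real numbers are an arbitrary realType R and the complex
   numbers are R[i]. *)
From HB Require Import structures.
From mathcomp Require Import all_boot all_order all_algebra.
From mathcomp Require Import reals complex.

Set Implicit Arguments.
Unset Strict Implicit.
Unset Printing Implicit Defensive.

Import Order.TTheory GRing.Theory Num.Theory.

Local Open Scope ring_scope.
Local Open Scope complex_scope.

Definition mx_invariant (R : realType) (n : nat) (M : 'M[R]_n)
    (V : {vspace 'cV[R]_n}) : Prop :=
  forall v, v \in V -> M *m v \in V.

Definition toC (R : realType) (m n : nat) (A : 'M[R]_(m, n)) : 'M[R[i]]_(m, n) :=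
  map_mx (real_complex R) A.

(* The sequence c lists x_0, ..., x_m in this order; a chain is never empty. *)
Definition jordan_chain (R : realType) (n : nat) (M : 'M[R]_n) (lambda0 : R[i])
    (c : seq 'cV[R[i]]_n) : Prop :=
  [/\ (0 < size c)%N,
      c`_0 != 0,
      toC M *m c`_0 = lambda0 *: c`_0 &
      forall j, (0 < j < size c)%N ->
        toC M *m c`_j - lambda0 *: c`_j = c`_j.-1].

(* The chains may overlap and may belong to different eigenvalues: X is their
   union as a set.  Linear independence is over the complex numbers. *)
Definition jordan_vectors (R : realType) (n : nat) (M : 'M[R]_n)
    (X : seq 'cV[R[i]]_n) : Prop :=
  free X /\
  exists cs : seq (seq 'cV[R[i]]_n),
    (forall c, c \in cs -> exists lambda0 : R[i], jordan_chain M lambda0 c) /\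
    X =i flatten cs.

(* The complex span of W, inside C^n.  A real subspace is said to have a basis
   of (possibly non-real) vectors of C^n when they are a complex basis of this
   span.  It does not depend on the basis of W used to generate it, see
   mem_complexification. *)
Definition complexification (R : realType) (n : nat) (W : {vspace 'cV[R]_n}) :
    {vspace 'cV[R[i]]_n} :=
  <<[seq toC w | w <- vbasis W]>>%VS.

Lemma toC_mem (R : realType) (n : nat) (W : {vspace 'cV[R]_n}) (w : 'cV[R]_n) :
  w \in W -> toC w \in complexification W.
Proof.
move=> /coord_vbasis ->.
rewrite /toC raddf_sum /=; apply: memv_suml => i _.
rewrite map_mxZ; apply/memvZ/memv_span/map_f.
by rewrite mem_nth // size_tuple.
Qed.

Lemma mem_complexification (R : realType) (n : nat) (W : {vspace 'cV[R]_n})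
    (z : 'cV[R[i]]_n) :
  (z \in complexification W) =
    (map_mx (@complex.Re R) z \in W) && (map_mx (@complex.Im R) z \in W).
Proof.
apply/idP/andP => [zW|[reW imW]]; last first.
  have -> : z = toC (map_mx (@complex.Re R) z) + 'i%C *: toC (map_mx (@complex.Im R) z).
    by apply/matrixP => i j; rewrite !mxE -complexE.
  by apply: memvD; [|apply: memvZ]; apply: toC_mem.
have [c ->] : exists c : 'I_(\dim W) -> R[i],
    z = \sum_(i < \dim W) c i *: toC (vbasis W)`_i.
  have zW' : z \in <<map_tuple (@toC R n 1) (vbasis W)>>%VS by [].
  exists (fun i => coord (map_tuple (@toC R n 1) (vbasis W)) i z).
  rewrite {1}(coord_span zW'); apply: eq_bigr => i _.
  by congr (_ *: _); rewrite /= (nth_map 0) ?size_tuple.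
have bW i : (i < \dim W)%N -> (vbasis W)`_i \in W.
  by move=> ltiW; rewrite vbasis_mem // mem_nth ?size_tuple.
split.
  have -> : map_mx (@complex.Re R) (\sum_(i < \dim W) c i *: toC (vbasis W)`_i) =
      \sum_(i < \dim W) complex.Re (c i) *: (vbasis W)`_i.
    apply/matrixP => a b; rewrite mxE !summxE raddf_sum.
    by apply: eq_bigr => i _; rewrite !mxE; case: (c i) => x y /=; rewrite mulr0 subr0.
  by apply: memv_suml => i _; apply/memvZ/bW.
have -> : map_mx (@complex.Im R) (\sum_(i < \dim W) c i *: toC (vbasis W)`_i) =
    \sum_(i < \dim W) complex.Im (c i) *: (vbasis W)`_i.
  apply/matrixP => a b; rewrite mxE !summxE raddf_sum.
  by apply: eq_bigr => i _; rewrite !mxE; case: (c i) => x y /=; rewrite mulr0 add0r.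
by apply: memv_suml => i _; apply/memvZ/bW.
Qed.

(* Main.v *)
Require Import Defs.
From HB Require Import structures.
From mathcomp Require Import all_boot all_order all_algebra.
From mathcomp Require Import reals complex.
Set Implicit Arguments.
Unset Strict Implicit.
Unset Printing Implicit Defensive.
Import Order.TTheory GRing.Theory Num.Theory.
Local Open Scope ring_scope.
Local Open Scope complex_scope.

(** If a subspace is spanned by Jordan vectors, it is stable under M because
    M x_j = lambda x_j + x_(j-1) stays in the span of the chain of x_j; taking
    real parts brings this back from the complexification to W.

    Conversely the complexification U of an invariant W is stable under M, and
    the point is that a stable subspace U over an algebraically closed field
    has a Jordan basis ([jordan_basis]).  This goes by induction on the
    dimension of U.  If U is not 0 it contains an eigenvector, for some
    eigenvalue lambda; put g = M - lambda and let K be the kernel of g in U.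
    Then T = g(U) is stable and smaller than U, so it has a basis made of
    chains.  Lengthen each lambda-chain of T by a preimage in U of its last
    vector, and add a basis of a complement of K :&: T in K, each vector of
    which is a chain of length one ([chains_up]).
     - The new vectors span U ([chains_up_span]): the image under g of their
       span S contains every vector of the old chains, hence g(S) = T = g(U),
       and S contains K.
     - There are at most dim U of them ([size_chains_up]): as the first vectors
       of the lambda-chains of T are independent and lie in K :&: T, at most
       dim (K :&: T) vectors have been appended, so that the total is at most
       dim T + dim (K :&: T) + (dim K - dim (K :&: T)) = dim U.
    A spanning family of at most dim U vectors is a basis, so no linear
    relation between the new vectors has to be examined. *)

(** * Eigenvectors in a stable subspace *)

Lemma size_basis_seq (K : fieldType) (vT : vectType K) (U : {vspace vT})
    (X : seq vT) :
  basis_of U X -> size X = \dim U.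
Proof.
by move=> XU; have /eqP <- := basis_free XU; rewrite (span_basis XU).
Qed.

Section Shifts.

Variables (F : closedFieldType) (n : nat) (A : 'M[F]_n).
Implicit Types (U : {vspace 'cV[F]_n}) (c : seq 'cV[F]_n).
Implicit Types (cs : seq (F * seq 'cV[F]_n)).

Definition shift (a : F) : 'End('cV[F]_n) := linfun (mulmx (A - a%:M)).

Lemma shiftE a v : shift a v = A *m v - a *: v.
Proof. by rewrite lfunE /= mulmxBl mul_scalar_mx. Qed.

Definition stable U := forall u, u \in U -> A *m u \in U.

Lemma shift_stable U a u : stable U -> u \in U -> shift a u \in U.
Proof. by move=> sU uU; rewrite shiftE rpredB ?rpredZ ?sU. Qed.

Lemma stable_shift_img U a : stable U -> stable (shift a @: U)%VS.
Proof.
move=> sU _ /memv_imgP[u uU ->].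
have -> : A *m shift a u = shift a (A *m u).
  by rewrite !shiftE mulmxBr -scalemxAr.
exact/memv_img/sU.
Qed.

(** When a product of shifts kills u, the last nonzero vector met while
    applying the factors one after the other is an eigenvector. *)
Lemma eigenvector_of_roots U (rs : seq F) u :
    stable U -> u \in U -> u != 0 -> foldr (fun r v => shift r v) u rs = 0 ->
  exists a v, [/\ v \in U, v != 0 & shift a v = 0].
Proof.
move=> sU uU u0; elim: rs => [|r rs IH] /= => [uz|vz].
  by rewrite uz eqxx in u0.
have [/IH//|v0] := eqVneq (foldr (fun r v => shift r v) u rs) 0.
exists r, (foldr (fun r v => shift r v) u rs); split=> //.
by elim: (rs) => //= b bs; apply: shift_stable.
Qed.

End Shifts.

(** By Cayley-Hamilton the product of the shifts by the roots of the
    characteristic polynomial kills every vector. *)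
Lemma stable_eigenvector (F : closedFieldType) n (A : 'M[F]_n)
    (U : {vspace 'cV[F]_n}) :
    stable A U -> U != 0%VS ->
  exists a v, [/\ v \in U, v != 0 & shift A a v = 0].
Proof.
move=> sU; rewrite -vpick0 => u0.
have [rs Ers] : exists rs : seq F,
    foldr (fun r v => shift A r v) (vpick U) rs = 0.
  case: n A U sU u0 => [|n] A U sU u0.
    by exists [::]; apply/matrixP => -[].
  have [rs /esym Ers] := closed_field_poly_normal (char_poly A).
  exists rs; rewrite (monicP (char_poly_monic A)) scale1r in Ers.
  have := Cayley_Hamilton A; rewrite -Ers rmorph_prod /= => pA0.
  transitivity ((\prod_(r <- rs) horner_mx A ('X - r%:P)) *m vpick U);
    last by rewrite pA0 mul0mx.
  elim: (rs) => [|r bs IH] /=; first by rewrite big_nil mul1mx.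
  rewrite big_cons -mulmxE -mulmxA -IH lfunE /=.
  by rewrite rmorphB /= horner_mx_X horner_mx_C.
exact: eigenvector_of_roots sU (memv_pick U) u0 Ers.
Qed.

(** * Jordan chains as paths *)

Section Chains.

Variables (F : closedFieldType) (n : nat) (A : 'M[F]_n).
Implicit Types (U S T : {vspace 'cV[F]_n}) (c : seq 'cV[F]_n).
Implicit Types (cs : seq (F * seq 'cV[F]_n)).

(** The eigenvector equation of x_0 and the equations that link x_j to
    x_(j-1) become one condition once the chain is preceded by 0.  That x_0 is
    nonzero is left to the independence of the family of chains. *)
Definition linked (a : F) : rel 'cV[F]_n := [rel x y | shift A a y == x].

Definition is_chain (ac : F * seq 'cV[F]_n) :=
  (ac.2 != [::]) && path (linked ac.1) 0 ac.2.

Definition vectors cs := flatten [seq ac.2 | ac <- cs].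

Lemma vectorsP cs x :
  reflect (exists2 ac, ac \in cs & x \in ac.2) (x \in vectors cs).
Proof. exact: flatten_mapP. Qed.

Lemma path_next (T : eqType) (e : rel T) x0 s x :
  path e x0 s -> x \in belast x0 s -> exists2 y, y \in s & e x y.
Proof.
elim: s x0 => //= y s IH x0 /andP[exy ps]; rewrite inE => /predU1P[->|xs].
  by exists y; rewrite ?mem_head.
by have [z zs exz] := IH _ ps xs; exists z; rewrite // inE zs orbT.
Qed.

(** On a b-chain the shift by a differs from an invertible scaling by b - a
    only by the previous vector, so the chain lies in the image of its span. *)
Lemma chain_shift_img S a b c :
    a != b -> path (linked b) 0 c -> {subset c <= S} ->
  {subset c <= (shift A a @: S)%VS}.
Proof.
move=> ab; have := mem0v (shift A a @: S)%VS.
move: (0 : 'cV[F]_n) => x0.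
elim: c x0 => // y c IH x0 gx0 /andP[/eqP yx0 pc] ycS.
have yS : y \in S by rewrite ycS ?mem_head.
have gy : y \in (shift A a @: S)%VS.
  have -> : y = (b - a)^-1 *: (shift A a y - x0).
    rewrite -yx0 !shiftE opprB [X in _ *: X]addrC addrA subrK -scalerBl scalerA.
    by rewrite mulVf ?scale1r // subr_eq0 eq_sym.
  by rewrite rpredZ // rpredB // memv_img.
move=> x; rewrite inE => /predU1P[-> //|xc].
by apply: IH gy pc _ x xc => z zc; rewrite ycS // inE zc orbT.
Qed.

(** * From a Jordan basis of g(U) to one of U *)

Section Step.

Variables (U : {vspace 'cV[F]_n}) (a : F) (cs : seq (F * seq 'cV[F]_n)).
Local Notation g := (shift A a).
Local Notation T := (g @: U)%VS.
Local Notation K := (U :&: lker g)%VS.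

Hypotheses (sU : stable A U) (csP : all is_chain cs).
Hypothesis (csT : basis_of T (vectors cs)).

(** A linear right inverse of the restriction of g to U. *)
Definition lift : 'End('cV[F]_n) := (projv U \o (g \o projv U)^-1)%VF.

Lemma lift_mem x : lift x \in U.
Proof. by rewrite comp_lfunE memv_proj. Qed.

Lemma liftK x : x \in T -> g (lift x) = x.
Proof.
move=> xT; rewrite comp_lfunE -[LHS]comp_lfunE limg_lfunVK //.
by rewrite limg_comp limg_proj.
Qed.

Definition extend (ac : F * seq 'cV[F]_n) :=
  if ac.1 == a then (a, rcons ac.2 (lift (last 0 ac.2))) else ac.

Definition chains_up :=
  map extend cs ++ [seq (a, [:: z]) | z <- vbasis (K :\: T)].

Lemma vectors_mem x : x \in vectors cs -> x \in T.
Proof. by move=> xc; rewrite -(span_basis csT) memv_span. Qed.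

Lemma img_sub : (T <= U)%VS.
Proof. by apply/subvP => _ /memv_imgP[u uU ->]; apply: shift_stable. Qed.

Lemma complement_mem z : z \in vbasis (K :\: T) -> z \in K.
Proof. by move=> /vbasis_mem; apply/subvP/diffvSl. Qed.

Lemma last_mem ac : ac \in cs -> last 0 ac.2 \in T.
Proof.
move=> acs; have /andP[c0 _] := allP csP _ acs.
case E: ac.2 c0 => [//|x c] _; apply: vectors_mem; apply/vectorsP.
by exists ac; rewrite // E /= mem_last.
Qed.

Lemma chains_up_chain : all is_chain chains_up.
Proof.
rewrite all_cat; apply/andP; split; apply/allP => x /mapP[].
  move=> ac acs ->; have /andP[c0 pc] := allP csP _ acs; rewrite /extend.
  case: eqP => [E|_]; last exact: allP csP _ acs.
  rewrite /is_chain /= -size_eq0 size_rcons rcons_path; rewrite E in pc.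
  by rewrite pc; apply/eqP/liftK/last_mem.
move=> z /complement_mem; rewrite memv_cap memv_ker => /andP[_ gz] ->.
by rewrite /is_chain /= andbT.
Qed.

Lemma chains_up_sub x : x \in vectors chains_up -> x \in U.
Proof.
have cU ac z : ac \in cs -> z \in ac.2 -> z \in U.
  move=> acs zc; apply: (subvP img_sub); apply: vectors_mem.
  by apply/vectorsP; exists ac.
move=> /vectorsP[ac]; rewrite mem_cat => /orP[] /mapP[].
  move=> bc bcs -> {ac}; rewrite /extend; case: eqP => _; last exact: cU.
  by rewrite mem_rcons inE => /predU1P[->|]; [apply: lift_mem | apply: cU].
move=> z /complement_mem + ->; rewrite memv_cap inE => /andP[zU _] /eqP ->.
exact: zU.
Qed.

Lemma extend_mem ac x :
  ac \in cs -> x \in (extend ac).2 -> x \in vectors chains_up.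
Proof.
move=> acs xc; apply/vectorsP; exists (extend ac) => //.
by rewrite mem_cat map_f.
Qed.

Lemma vectors_sub : {subset vectors cs <= vectors chains_up}.
Proof.
move=> x /vectorsP[ac acs xc]; apply: extend_mem acs _.
by rewrite /extend; case: eqP => // _; rewrite mem_rcons inE xc orbT.
Qed.

(** It is enough that S contains K and that g(S) contains T: for u in U pick s
    in S with g(u) = g(s), then u - s is in K. *)
Lemma chains_up_span : (U <= <<vectors chains_up>>)%VS.
Proof.
set S := <<_>>%VS.
have SU x : x \in S -> x \in U.
  by apply/subvP/span_subvP => z; apply: chains_up_sub.
have TS : (T <= S)%VS by rewrite -(span_basis csT); apply: sub_span vectors_sub.
have KS : (K <= S)%VS.
  rewrite -(addv_diff_cap K T) subv_add (subv_trans (capvSr _ _) TS) andbT.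
  rewrite -[X in (X <= _)%VS](span_basis (vbasisP _)); apply: sub_span => z zK.
  apply/vectorsP; exists (a, [:: z]); rewrite ?mem_head //.
  by rewrite mem_cat map_f ?orbT.
have TgS : (T <= g @: S)%VS.
  rewrite -(span_basis csT); apply/span_subvP => x /vectorsP[ac acs xc].
  have [E|ne] := eqVneq ac.1 a; last first.
    have /andP[_ pc] := allP csP _ acs.
    apply: (chain_shift_img _ pc) xc => [|z zc]; first by rewrite eq_sym.
    by apply/memv_span/(extend_mem acs); rewrite /extend (negPf ne).
  have /allP/(_ (extend ac)) := chains_up_chain.
  rewrite mem_cat map_f // => /(_ isT).
  (* in the lengthened chain every vector of the old one has a successor *)
  move=> /andP[_ /path_next]/(_ x).
  have -> : x \in belast 0 (extend ac).2.
    by rewrite /extend E eqxx /= belast_rcons inE xc orbT.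
  move=> /(_ isT)[y yc /eqP]; rewrite {1}/extend E eqxx /= => <-.
  exact/memv_img/memv_span/(extend_mem acs).
apply/subvP => u uU.
have /(subvP TgS)/memv_imgP[s sS gus] := memv_img g uU.
rewrite -[u](subrK s) rpredD // (subvP KS) // memv_cap rpredB ?(SU s) //=.
by rewrite memv_ker linearB /= gus subrr.
Qed.

Lemma subseq_heads :
  subseq [seq head 0 ac.2 | ac <- cs & ac.1 == a] (vectors cs).
Proof.
elim: cs csP => //= -[b c] ds IH /andP[/andP[c0 _] /IH sds].
rewrite /vectors /=; case: eqP => _ /=; last first.
  exact: subseq_trans sds (suffix_subseq _ _).
case: c c0 => //= x c _; rewrite eqxx.
exact: subseq_trans sds (suffix_subseq _ _).
Qed.

(** Only the chains with eigenvalue a are lengthened; their first vectors are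
    part of a basis of T and are killed by g. *)
Lemma count_chains : (count [pred ac | ac.1 == a] cs <= \dim (K :&: T))%N.
Proof.
set hs := [seq head 0 ac.2 | ac <- cs & ac.1 == a].
have -> : count [pred ac | ac.1 == a] cs = size hs.
  by rewrite size_map size_filter.
have hs_sub : subseq hs (vectors cs) := subseq_heads.
have cs_free := basis_free csT.
have /eqP <- : free hs.
  have /(subseq_uniqP (free_uniq cs_free)) -> := hs_sub.
  exact: filter_free.
apply/dimvS/span_subvP => x xh.
have xT := vectors_mem (mem_subseq hs_sub xh).
rewrite !memv_cap xT (subvP img_sub) //= andbT memv_ker.
move: xh => /mapP[ac]; rewrite mem_filter => /andP[/eqP E acs] ->.
have /andP[] := allP csP _ acs.
by rewrite E; case: ac.2 => //= y c _ /andP[].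
Qed.

Lemma size_chains_up : (size (vectors chains_up) <= \dim U)%N.
Proof.
have size_ext : size (vectors (map extend cs)) =
    (size (vectors cs) + count [pred ac | ac.1 == a] cs)%N.
  rewrite /vectors; elim: (cs) => //= ac ds IH; rewrite !size_cat IH /extend.
  by case: eqP => _ /=; rewrite ?size_rcons ?addSn ?addnS addnA.
have -> : size (vectors chains_up) =
    (size (vectors (map extend cs)) + \dim (K :\: T))%N.
  rewrite /vectors map_cat flatten_cat size_cat; congr (_ + _)%N.
  by rewrite -map_comp flatten_map1 size_map size_tuple.
rewrite size_ext (size_basis_seq csT) -(limg_ker_dim g U) -(dimv_cap_compl K T).
by rewrite -addnA addnC leq_add2r leq_add2r count_chains.
Qed.

Lemma chains_up_basis : basis_of U (vectors chains_up).
Proof. by rewrite basisEdim chains_up_span size_chains_up. Qed.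

End Step.

(** An eigenvector in U makes g(U) smaller than U, so that the induction
    hypothesis applies to g(U). *)
Theorem jordan_basis U :
  stable A U -> exists cs, all is_chain cs /\ basis_of U (vectors cs).
Proof.
have [d] := ubnP (\dim U); elim: d U => // d IH U dU sU.
have [U0|nzU] := eqVneq U 0%VS.
  by exists [::]; split=> //; rewrite U0 basisEdim sub0v dimv0.
have [a [v [vU v0 gv]]] := stable_eigenvector sU nzU.
have dT : (\dim (shift A a @: U) < d)%N.
  rewrite -ltnS; apply: leq_trans dU; rewrite ltnS.
  rewrite -(limg_ker_dim (shift A a) U) -[X in (X < _)%N]add0n ltn_add2r.
  rewrite lt0n dimv_eq0.
  apply: contraNneq v0 => K0.
  by rewrite -memv0 -K0 memv_cap vU memv_ker gv eqxx.
have [cs [csP csT]] := IH _ dT (stable_shift_img (a := a) sU).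
exists (chains_up U a cs); split; first exact: chains_up_chain.
exact: chains_up_basis.
Qed.

End Chains.

(** * Real matrices and their complexification *)

Section Real.

Variables (R : realType) (n : nat) (M : 'M[R]_n).

Lemma Re_toC (w : 'cV[R]_n) : map_mx (@complex.Re R) (toC w) = w.
Proof. by apply/matrixP => i j; rewrite !mxE. Qed.

(** W is recovered from its complexification by taking real parts, and the
    complexification is spanned by real vectors of W. *)
Lemma mx_invariantP (W : {vspace 'cV[R]_n}) :
  mx_invariant M W <-> stable (toC M) (complexification W).
Proof.
have toCM v : toC M *m toC v = toC (M *m v) by rewrite /toC map_mxM.
split=> [sW z zW | sW w /toC_mem/sW]; last first.
  by rewrite toCM mem_complexification Re_toC => /andP[].
have : (linfun (mulmx (toC M)) @: complexification W <= complexification W)%VS.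
  rewrite limg_span; apply/span_subvP => _ /mapP[_ /mapP[w wW ->] ->].
  by rewrite lfunE /= toCM toC_mem // sW // vbasis_mem.
by move=> /subvP/(_ _ (memv_img _ zW)); rewrite lfunE.
Qed.

Lemma path_jordan_chain (a : R[i]) (c : seq 'cV[R[i]]_n) :
    c != [::] -> 0 \notin c -> path (linked (toC M) a) 0 c ->
  jordan_chain M a c.
Proof.
case: c => // x c _ c0 pc.
have link j : (j < size (x :: c))%N ->
    toC M *m (x :: c)`_j - a *: (x :: c)`_j = (0 :: x :: c)`_j.
  by move=> lt_j; have /eqP := pathP 0 pc j lt_j; rewrite shiftE.
split=> //.
- by apply: contraNneq c0 => <-; rewrite mem_head.
- by apply/eqP; rewrite -subr_eq0 (link 0%N).
by case=> // j lt_j; apply: link.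
Qed.

Lemma jordan_chain_stable (a : R[i]) (c : seq 'cV[R[i]]_n)
    (S : {vspace 'cV[R[i]]_n}) x :
  jordan_chain M a c -> {subset c <= S} -> x \in c -> toC M *m x \in S.
Proof.
move=> [_ _ eig link] cS /(nthP 0)[[|j] lt_j <-].
  by rewrite eig rpredZ // cS ?mem_nth.
rewrite -[_ *m _](subrK (a *: c`_j.+1)) link //.
by rewrite rpredD ?rpredZ ?cS ?mem_nth //= ltnW.
Qed.

Lemma jordan_vectors_stable (X : seq 'cV[R[i]]_n) :
  jordan_vectors M X -> stable (toC M) <<X>>%VS.
Proof.
move=> [_ [cs [csP Xcs]]] z zX.
have : (linfun (mulmx (toC M)) @: <<X>> <= <<X>>)%VS.
  rewrite limg_span; apply/span_subvP => _ /mapP[x + ->].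
  rewrite lfunE Xcs => /flattenP[c cc xc]; have [a ac] := csP c cc.
  apply: jordan_chain_stable ac _ xc => y yc.
  by apply: memv_span; rewrite Xcs; apply/flattenP; exists c.
by move=> /subvP/(_ _ (memv_img _ zX)); rewrite lfunE.
Qed.

Lemma chains_jordan_vectors (cs : seq (R[i] * seq 'cV[R[i]]_n)) :
  all (is_chain (toC M)) cs -> free (vectors cs) ->
  jordan_vectors M (vectors cs).
Proof.
move=> csP fcs; split=> //; exists [seq ac.2 | ac <- cs].
split=> // _ /mapP[ac acs ->].
exists ac.1; have /andP[c0 pc] := allP csP _ acs.
apply: path_jordan_chain c0 _ pc; apply/negP => z0.
suff /(free_not0 fcs)/eqP : 0 \in vectors cs by [].
by apply/vectorsP; exists ac.
Qed.

End Real.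

Lemma dim_complexification (R : realType) n (W : {vspace 'cV[R]_n}) :
  \dim (complexification W) = \dim W.
Proof.
pose B := map_tuple (@toC R n 1) (vbasis W).
suff /eqP -> : free B by rewrite size_tuple.
have nthB (i : 'I_(\dim W)) : B`_i = toC (vbasis W)`_i.
  by rewrite (nth_map 0) ?size_tuple.
apply/freeP => k kB0 i.
have /freeP bW := basis_free (vbasisP W).
(* the real and imaginary parts of the coefficients are relations over W *)
have Re0 : complex.Re (k i) = 0.
  apply: (bW (fun j => complex.Re (k j))); apply/matrixP => p q.
  transitivity (complex.Re ((\sum_j k j *: B`_j) p q));
    last by rewrite kB0 !mxE.
  rewrite !summxE raddf_sum; apply: eq_bigr => j _.
  by rewrite nthB !mxE; case: (k j) => x y /=; rewrite mulr0 subr0.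
have Im0 : complex.Im (k i) = 0.
  apply: (bW (fun j => complex.Im (k j))); apply/matrixP => p q.
  transitivity (complex.Im ((\sum_j k j *: B`_j) p q));
    last by rewrite kB0 !mxE.
  rewrite !summxE raddf_sum; apply: eq_bigr => j _.
  by rewrite nthB !mxE; case: (k j) => x y /=; rewrite mulr0 add0r.
by rewrite [k i]complexE Re0 Im0 mulr0 addr0.
Qed.

Theorem proposition1 (R : realType) (n k : nat) (M : 'M[R]_n)
    (W : {vspace 'cV[R]_n}) (dimW : \dim W = k) :
  mx_invariant M W <->
  exists X : k.-tuple 'cV[R[i]]_n,
    basis_of (complexification W) X /\ jordan_vectors M X.
Proof.
rewrite mx_invariantP; split=> [sW | [X [XW XM]]]; last first.
  by rewrite -(span_basis XW); apply: jordan_vectors_stable.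
have [cs [csP csW]] := jordan_basis sW.
have szk : size (vectors cs) == k.
  by rewrite (size_basis_seq csW) dim_complexification dimW.
exists (Tuple szk); split=> //.
exact: chains_jordan_vectors (basis_free csW).
Qed.
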